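(* Let $\mathcal{C}\subseteq(\mathbb{C}^a)^{\otimes n}$ be a quantum locally recoverable code of block length $n$, dimension $k>0$, distance $d$, and locality $r$. Then \[ k \leq n-2(d-1)-\left\lfloor\frac{n-(d-1)}{r}\right\rfloor-\left\lfloor\frac{n-2(d-1)-\left\lfloor\frac{n-(d-1)}{r}\right\rfloor}{r}\right\rfloor . \]
   Context: $[n]=\{0,\dots,n-1\}$. A quantum code of block length $n$, local dimension $a$ and dimension $k$ is an $a^k$-dimensional linear subspace $\mathcal{C}\subseteq(\mathbb{C}^a)^{\otimes n}$; a code state is (the density matrix of) a unit vector in $\mathcal{C}$. For a state $\rho$ on qudits $A$ and $B\subseteq A$, $\rho_B$ denotes the reduced density matrix on $B$; $\mathcal{M}(A)$ denotes density matrices on qudits $A$. The code can decode from erasures in $S\subseteq[n]$ if there is a quantum channel $\mathrm{Dec}^S:\mathcal{M}([n]\setminus S)\to\mathcal{M}([n])$ with $\mathrm{Dec}^S(\psi_{[n]\setminus S})=\psi$ for every code state $\psi$. The distance $d$ is the maximum $d$ such that the code can decode from erasures in every $S$ with $|S|<d$. The code is a quantum locally recoverable code (qLRC) of locality $r$ if for every $i\in[n]$ there is a set $I_i\subseteq[n]$ with $i\in I_i$, $|I_i|\le r$, and a quantum channel $\mathrm{Rec}_i:\mathcal{M}(I_i\setminus\{i\})\to\mathcal{M}(I_i)$ such that $(\mathrm{Rec}_i\otimes \mathrm{id}_{[n]\setminus I_i})(\psi_{[n]\setminus\{i\}})=\psi$ for every code state $\psi$. *)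

(* Defs.v *)
From HB Require Import structures.
From mathcomp Require Import all_boot all_order all_algebra.
From mathcomp Require Import reals complex.
Set Implicit Arguments.
Unset Strict Implicit.
Unset Printing Implicit Defensive.
Import Order.TTheory GRing.Theory Num.Theory.
Local Open Scope ring_scope.

Section QLRC.
Variables (R : realType) (n a : nat).
Local Notation C := R[i].

(* Computational basis states of the qudits in B ⊆ [n]: an assignment of a
   value in 'I_a to every qudit of B (encoded as a partial map that is defined
   exactly on B). *)
Definition cfg (B : {set 'I_n}) : finType :=
  {x : {ffun 'I_n -> option 'I_a} | [forall i, (i \in B) == isSome (x i)]}.

(* Operators on the Hilbert space with orthonormal basis T. *)
Definition op (T : finType) := T -> T -> C.

Definition trace (T : finType) (rho : op T) : C := \sum_(x : T) rho x x.

Definition psd (T : finType) (rho : op T) : Prop :=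
  forall v : T -> C, 0 <= \sum_(x : T) \sum_(y : T) (v x)^* * rho x y * v y.

Definition density (T : finType) (rho : op T) : Prop :=
  psd rho /\ trace rho = 1.

Definition linear_map (T U : finType) (Phi : op T -> op U) : Prop :=
  forall (c : C) (rho sigma : op T) (x y : U),
    Phi (fun u v => c * rho u v + sigma u v) x y = c * Phi rho x y + Phi sigma x y.

(* Phi ⊗ id_m acting on operators on T ⊗ C^m *)
Definition ampl (T U : finType) (m : nat) (Phi : op T -> op U)
  (rho : op (T * 'I_m)%type) : op (U * 'I_m)%type :=
  fun p q => Phi (fun u v => rho (u, p.2) (v, q.2)) p.1 q.1.

Definition completely_positive (T U : finType) (Phi : op T -> op U) : Prop :=
  forall (m : nat) (rho : op (T * 'I_m)%type), psd rho -> psd (ampl Phi rho).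

Definition trace_preserving (T U : finType) (Phi : op T -> op U) : Prop :=
  forall rho : op T, trace (Phi rho) = trace rho.

Definition channel (T U : finType) (Phi : op T -> op U) : Prop :=
  [/\ linear_map Phi, completely_positive Phi & trace_preserving Phi].

(* w (on D) is the juxtaposition of y (on B) and e (on the complement of B in D) *)
Definition glue (D B E : {set 'I_n}) (w : cfg D) (y : cfg B) (e : cfg E) : bool :=
  [forall j, val w j == (if j \in B then val y j else val e j)].

(* partial trace: rho on A  |->  rho_B = Tr_{A \ B} rho, for B ⊆ A *)
Definition ptr (A B : {set 'I_n}) (rho : op (cfg A)) : op (cfg B) :=
  fun x x' => \sum_(z : cfg (A :\: B)) \sum_(w : cfg A) \sum_(w' : cfg A)
     (if glue w x z && glue w' x' z then rho w w' else 0).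

(* (Phi ⊗ id_E) rho, where Phi : M(A) -> M(B), rho on D = A ⊔ E, result on
   D' = B ⊔ E. *)
Definition apply_id (A B E D D' : {set 'I_n}) (Phi : op (cfg A) -> op (cfg B))
  (rho : op (cfg D)) : op (cfg D') :=
  fun w w' => \sum_(y : cfg B) \sum_(y' : cfg B) \sum_(e : cfg E) \sum_(e' : cfg E)
    (if glue w y e && glue w' y' e' then
       Phi (fun x x' => \sum_(v : cfg D) \sum_(v' : cfg D)
              (if glue v x e && glue v' x' e' then rho v v' else 0)) y y'
     else 0).

Definition cfgT := cfg [set: 'I_n].
Definition dimH := #|cfgT|.

(* code states of the code with subspace = row space of V *)
Definition code_state (V : 'M[C]_dimH) (psi : 'rV[C]_dimH) : Prop :=
  (psi <= V)%MS /\ \sum_(j < dimH) psi 0 j * (psi 0 j)^* = 1.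

Definition pure (psi : 'rV[C]_dimH) : op cfgT :=
  fun x x' => psi 0 (enum_rank x) * (psi 0 (enum_rank x'))^*.

Definition decodes (V : 'M[C]_dimH) (S : {set 'I_n}) : Prop :=
  exists Dec : op (cfg (~: S)) -> op cfgT,
    channel Dec /\
    forall psi, code_state V psi ->
      forall x x', Dec (@ptr [set: 'I_n] (~: S) (pure psi)) x x' = pure psi x x'.

Definition is_distance (V : 'M[C]_dimH) (d : nat) : Prop :=
  (forall S : {set 'I_n}, #|S| < d -> decodes V S)%N /\
  (forall d', (forall S : {set 'I_n}, #|S| < d' -> decodes V S) -> d' <= d)%N.

Definition is_qLRC (V : 'M[C]_dimH) (r : nat) : Prop :=
  forall i : 'I_n, exists I : {set 'I_n},
    [/\ i \in I, (#|I| <= r)%N &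
      exists Rec : op (cfg (I :\ i)) -> op (cfg I),
        channel Rec /\
        forall psi, code_state V psi ->
          forall x x',
            @apply_id (I :\ i) I (~: I) (~: [set i]) [set: 'I_n] Rec
              (@ptr [set: 'I_n] (~: [set i]) (pure psi)) x x' = pure psi x x'].

End QLRC.

(* Main.v *)
(* Call a set A of qudits correctable if it carries no information on the code
   state: the reduction to A of |u><u| is |u|^2 times a fixed operator (the
   Knill-Laflamme condition).
   - If a channel restores a pure state on its output and its environment, the
     joint state with the erased qudits has a pure marginal, hence is a product;
     the factor on the erased qudits does not depend on the code state, by the
     parallelogram identity. So erasable sets are correctable, and A correctable
     disjoint from a recovery set I containing i gives i |: A correctable, its
     reduced state being a product.
   - If A and B are disjoint and correctable and C is the rest, then ranks replace
     entropies in the usual proof of the quantum Singleton bound: with K the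
     dimension of the code and sA, sB the fixed operators,
     K rk(sA) <= rk(sB) a^|C| and K rk(sB) <= rk(sA) a^|C|, so K <= a^|C|.
   - A greedy choice gives correctable A with d - 1 + x elements, where
     x = (n - (d - 1)) / r, and then correctable B in the complement of A with
     d - 1 + y elements, where y = (n - 2(d - 1) - x) / r. *)
Require Import Defs.
From HB Require Import structures.
From mathcomp Require Import all_boot all_order all_algebra.
From mathcomp Require Import reals complex boolp zify ring.
Import Order.TTheory GRing.Theory Num.Theory.
Local Open Scope ring_scope.

Set Implicit Arguments.
Unset Strict Implicit.
Unset Printing Implicit Defensive.

(** * Finite sums over pairs of indices *)

Lemma sum_pair (M : nmodType) (T U : finType) (F : T * U -> M) :
  \sum_p F p = \sum_x \sum_y F (x, y).
Proof. by rewrite pair_bigA; apply: eq_bigr => -[]. Qed.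

Lemma sum_if_pair (M : nmodType) (T U : finType) (x : T) (y : U) (F : T -> U -> M) :
  \sum_t \sum_u (if (t == x) && (u == y) then F t u else 0) = F x y.
Proof.
rewrite (bigD1 x) //= (bigD1 y) //= !eqxx /= !big1 ?addr0 // => [t|u] /negbTE h.
  by apply: big1 => u _; rewrite h.
by rewrite h.
Qed.

(** * Ranks of Gram matrices and tripartite vectors *)

Section Ranks.
Variable C : numClosedFieldType.

Definition fmx (T U : finType) (f : T -> U -> C) : 'M[C]_(#|T|, #|U|) :=
  \matrix_(i, j) f (enum_val i) (enum_val j).

Lemma sum_enum_val (T : finType) (F : T -> C) :
  \sum_(i < #|T|) F (enum_val i) = \sum_x F x.
Proof.
rewrite [RHS](reindex (@enum_val T T)) //.
by exists enum_rank => x _; [exact: enum_valK | exact: enum_rankK].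
Qed.

Lemma mul_fmx (T U W : finType) (f : T -> U -> C) (g : U -> W -> C) :
  fmx f *m fmx g = fmx (fun x z => \sum_y f x y * g y z).
Proof.
apply/matrixP=> i j; rewrite !mxE -[RHS]sum_enum_val.
by apply: eq_bigr => k _; rewrite !mxE.
Qed.

(** If [X] kills [M M^H] from the left, then [(X M)(X M)^H = 0]; its diagonal entries are sums of
    squared moduli, so [X M = 0]. Hence [M] and its Gram matrix have the same left kernel. *)
Lemma mxrank_gram m n (M : 'M[C]_(m, n)) :
  \rank (M *m (map_mx Num.conj M)^T) = \rank M.
Proof.
apply/eqP; rewrite eqn_leq mxrankM_maxl /=.
set X := M *m _.
have Y0 : kermx X *m M = 0.
  set Y := _ *m M.
  have YY : Y *m (map_mx Num.conj Y)^T = 0.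
    by rewrite map_mxM trmx_mul /Y mulmxA -(mulmxA _ M) mulmx_ker mul0mx.
  apply/matrixP=> i j; rewrite mxE.
  have /eqP := congr1 (fun Z : 'M_m => Z i i) YY; rewrite !mxE psumr_eq0.
    move=> /allP/(_ j (mem_index_enum _)) /=; rewrite !mxE.
    by rewrite -normCK expf_eq0 /= normr_eq0 => /eqP.
  by move=> k _; rewrite !mxE mul_conjC_ge0.
have: (kermx X <= kermx M)%MS by apply/sub_kermxP.
move/mxrankS; rewrite !mxrank_ker leq_subLR => h.
by have := rank_leq_row M; have := rank_leq_row X; lia.
Qed.

(** The large matrix is the Kronecker product of [G] and [S]. Multiplied by [1 (x) U] on the left
    and [G^-1 (x) W] on the right, where [U S W] is the identity of size [\rank S], it becomes the
    identity of size [K * \rank S]. *)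
Lemma mxrank_tens_ge (K : nat) (T : finType) (G : 'M[C]_K) (s : T -> T -> C) :
  G \in unitmx ->
  (K * \rank (fmx s) <=
   \rank (fmx (fun p p' : ('I_K * T)%type => (G p.1 p'.1 * s p.2 p'.2)%R)))%N.
Proof.
move=> Gu; set S := fmx s; set r := \rank S; set KR := fmx _.
pose U := pinvmx (col_base S); pose W := pinvmx (row_base S).
have USW : U *m S *m W = 1%:M.
  have -> : U *m S = row_base S.
    by rewrite -[X in _ *m X](mulmx_base S) mulmxA mulVpmx ?col_base_full ?mul1mx.
  by rewrite mulmxVp ?row_base_free.
clearbody U W.
pose X := fmx (fun (q : ('I_K * 'I_r)%type) (p : ('I_K * T)%type) =>
  (q.1 == p.1)%:R * U q.2 (enum_rank p.2)).
pose Y := fmx (fun (p : ('I_K * T)%type) (q : ('I_K * 'I_r)%type) =>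
  invmx G p.1 q.1 * W (enum_rank p.2) q.2).
have XY : X *m KR *m Y = 1%:M.
  rewrite !mul_fmx; apply/matrixP=> q q'; rewrite !mxE.
  rewrite -(inj_eq enum_val_inj).
  case: (enum_val q) (enum_val q') => [i u] [i' u'] /=.
  have -> : ((i, u) == (i', u'))%:R = (1%:M : 'M[C]_K) i i' * (1%:M : 'M[C]_r) u u'.
    by rewrite !mxE xpair_eqE -natrM mulnb.
  rewrite -(mulmxV Gu) -USW !mxE mulr_suml sum_pair /=.
  apply: eq_bigr => j _.
  rewrite mulr_sumr -[LHS]sum_enum_val; apply: eq_bigr => b _.
  rewrite sum_pair /= (bigD1 i) //= [X in _ + X]big1 ?addr0; last first.
    move=> k /negbTE ki; apply: big1 => a _.
    by rewrite eq_sym ki !mul0r.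
  rewrite !mxE enum_valK -[X in X * _ = _]sum_enum_val !mulr_suml mulr_sumr.
  apply: eq_bigr => a _; rewrite !mxE eqxx enum_valK mul1r; ring.
have h := mxrankM_maxl (X *m KR) Y; rewrite XY mxrank1 in h.
apply: leq_trans (mxrankM_maxr X KR); apply: leq_trans h.
by rewrite card_prod !card_ord.
Qed.

Lemma sum_deltal (T : finType) (x : T) (F : T -> C) :
  \sum_y (y == x)%:R * F y = F x.
Proof.
rewrite (bigD1 x) //= eqxx mul1r big1 ?addr0 // => y /negbTE ->.
by rewrite mul0r.
Qed.

(** The left-hand matrix is the sum of its slices at fixed [c]. Each slice has [N^T] as a factor, so
    its rank is at most that of [N], and there are [#|TC|] slices. *)
Lemma mxrank_unfold (I TA TB TC : finType) (psi : I -> TA -> TB -> TC -> C) :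
  (\rank (fmx (fun (p : I * TA) (q : TB * TC) => psi p.1 p.2 q.1 q.2)%type) <=
   \rank (fmx (fun y (t : I * TA * TC) => psi t.1.1 t.1.2 y t.2)%type)
   * #|TC|)%N.
Proof.
set M := fmx _; set N := fmx _.
pose E c := fmx (fun (p : (I * TA)%type) (t : (I * TA * TC)%type) =>
  (t == (p.1, p.2, c))%:R).
pose Z c := fmx (fun y (q : (TB * TC)%type) => (q == (y, c))%:R).
have EN c : E c *m (N^T *m Z c) =
    fmx (fun p q => \sum_y (q == (y, c))%:R * psi p.1 p.2 y c).
  have -> : N^T = fmx (fun (t : (I * TA * TC)%type) y => psi t.1.1 t.1.2 y t.2).
    by apply/matrixP=> i j; rewrite !mxE.
  rewrite !mul_fmx; apply/matrixP=> p q; rewrite !mxE sum_deltal /=.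
  by apply: eq_bigr => y _; rewrite mulrC.
have -> : M = \sum_c E c *m (N^T *m Z c).
  apply/matrixP=> p q; rewrite summxE mxE.
  under eq_bigr => c _ do rewrite EN mxE.
  case: (enum_val p) (enum_val q) => [i a] [b c] /=.
  rewrite exchange_big (bigD1 b) //= [X in _ + X]big1 ?addr0.
    rewrite -(sum_deltal c (psi i a b)).
    by apply: eq_bigr => c' _; rewrite xpair_eqE eqxx eq_sym.
  move=> y /negbTE yb; apply: big1 => c' _.
  by rewrite xpair_eqE (eq_sym b) yb mul0r.
rewrite mulnC -sum_nat_const.
elim/big_ind2: _ => [|A a B b hA hB|c _]; first by rewrite mxrank0.
  exact: leq_trans (mxrank_add _ _) (leq_add hA hB).
apply: leq_trans (mxrankM_maxr _ _) _.
by apply: leq_trans (mxrankM_maxl _ _) _; rewrite mxrank_tr.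
Qed.

(** Two cuts of one tensor are compared: the Gram matrix of the cut [IA | BC] is [G (x) sA], that of
    the cut [B | IAC] is a multiple of [sB]. [mxrank_unfold] relates the ranks of the two cuts. *)
Lemma tripartite_rank_half (K : nat) (TA TB TC : finType)
    (psi : 'I_K -> TA -> TB -> TC -> C) (G : 'M[C]_K)
    (sA : TA -> TA -> C) (sB : TB -> TB -> C) :
  G \in unitmx ->
  (forall i j x x', \sum_y \sum_z psi i x y z * (psi j x' y z)^* =
     G i j * sA x x') ->
  (forall i j y y', \sum_x \sum_z psi i x y z * (psi j x y' z)^* =
     G i j * sB y y') ->
  (K * \rank (fmx sA) <= \rank (fmx sB) * #|TC|)%N.
Proof.
move=> Gu hA hB; apply: leq_trans (mxrank_tens_ge sA Gu) _.
set KR := fmx _.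
set M := fmx (fun (p : 'I_K * TA) (q : TB * TC) => psi p.1 p.2 q.1 q.2)%type.
set N := fmx (fun y (t : 'I_K * TA * TC) => psi t.1.1 t.1.2 y t.2)%type.
have trfmx (T U : finType) (f : T -> U -> C) :
  (map_mx Num.conj (fmx f))^T = fmx (fun x y => (f y x)^*).
  by apply/matrixP=> i j; rewrite !mxE.
have -> : KR = M *m (map_mx Num.conj M)^T.
  rewrite trfmx mul_fmx; apply/matrixP=> i j; rewrite !mxE sum_pair /=.
  by rewrite hA.
rewrite mxrank_gram; apply: leq_trans (mxrank_unfold psi) _.
rewrite leq_mul2r; apply/orP; right.
(* The trace of [G] comes from summing [hB] over [i = j]. *)
rewrite -(mxrank_gram N) (_ : _ *m _ = \tr G *: fmx sB).
  exact/mxrankS/scalemx_sub.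
rewrite trfmx mul_fmx; apply/matrixP=> i j; rewrite !mxE sum_pair sum_pair /=.
by rewrite mulr_suml; apply: eq_bigr => k _; rewrite hB.
Qed.

Lemma tripartite_rank (K : nat) (TA TB TC : finType)
    (psi : 'I_K -> TA -> TB -> TC -> C) (G : 'M[C]_K)
    (sA : TA -> TA -> C) (sB : TB -> TB -> C) :
  G \in unitmx ->
  (forall i j, \sum_x \sum_y \sum_z psi i x y z * (psi j x y z)^* = G i j) ->
  (forall i j x x', \sum_y \sum_z psi i x y z * (psi j x' y z)^* =
     G i j * sA x x') ->
  (forall i j y y', \sum_x \sum_z psi i x y z * (psi j x y' z)^* =
     G i j * sB y y') ->
  (K <= #|TC|)%N.
Proof.
move=> Gu hG hA hB; have [->//|K0] := posnP K.
have hAB := tripartite_rank_half Gu hA hB.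
pose psi' i y x z := psi i x y z.
have hBA := @tripartite_rank_half K TB TA TC psi' G sB sA Gu hB hA.
(* A vanishing [sA] would force [G = 0], which is singular because [K > 0]. *)
have sA0 : (0 < \rank (fmx sA))%N.
  rewrite lt0n mxrank_eq0; apply/eqP => /matrixP sA0.
  have G0 : G = 0.
    apply/matrixP=> i j; rewrite -hG mxE; apply: big1 => x _.
    by rewrite hA; have := sA0 (enum_rank x) (enum_rank x);
      rewrite !mxE enum_rankK => ->; rewrite mulr0.
  move: Gu; rewrite -row_free_unit G0 /row_free mxrank0 => /eqP; lia.
(* Chaining [hAB] and [hBA] gives [K^2 rk(sA) <= rk(sA) #|TC|^2], and the positive rank cancels. *)
rewrite -(@leq_sqr K); nia.
Qed.
End Ranks.

(** * Operators with a pure marginal *)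

Section Product.
Variable R : realType.
Local Notation C := R[i].

Definition sesq (T : finType) (rho : op R T) (v w : T -> C) : C :=
  \sum_x \sum_y (v x)^* * rho x y * w y.

Lemma sesq_linl (T : finType) (rho : op R T) (c d : C) (v v' w : T -> C) :
  sesq rho (fun x => c * v x + d * v' x) w =
  c^* * sesq rho v w + d^* * sesq rho v' w.
Proof.
rewrite /sesq !mulr_sumr -big_split; apply: eq_bigr => x _ /=.
rewrite !mulr_sumr -big_split; apply: eq_bigr => y _ /=.
by rewrite rmorphD !rmorphM; ring.
Qed.

Lemma sesq_linr (T : finType) (rho : op R T) (c d : C) (v w w' : T -> C) :
  sesq rho v (fun x => c * w x + d * w' x) =
  c * sesq rho v w + d * sesq rho v w'.
Proof.
rewrite /sesq !mulr_sumr -big_split; apply: eq_bigr => x _ /=.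
rewrite !mulr_sumr -big_split; apply: eq_bigr => y _ /=; ring.
Qed.

(* [sesq rho (t v + w) (t v + w)] is a nonnegative affine function of the
   complex number [t], hence constant. *)
Lemma psd_isotropic (T : finType) (rho : op R T) (v w : T -> C) :
  psd rho -> sesq rho v v = 0 -> sesq rho w v = 0 /\ sesq rho v w = 0.
Proof.
move=> rho_ge0 v0; set b := sesq rho w v; set c := sesq rho v w.
have z0 t : t * b + t^* * c = 0.
  apply/eqP/negPn/negP => z0; set z := _ + _ in z0.
  have z_ge (s : C) : s \is Num.real -> 0 <= s * z + sesq rho w w.
    move=> /CrealP sR.
    have := rho_ge0 (fun x => s * t * v x + 1 * w x).
    rewrite -/(sesq _ _ _) sesq_linl !sesq_linr v0 -/b -/c rmorphM /= sR conjC1.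
    by congr (0 <= _); rewrite /z; ring.
  have q_ge0 : 0 <= sesq rho w w by apply: rho_ge0.
  have zR : z \is Num.real.
    have := z_ge 1 (rpred1 _); rewrite mul1r => /ger0_real.
    by move=> h; rewrite -(addrK (sesq rho w w) z) rpredB // ger0_real.
  (* At this real [s] the quantity [s z + sesq rho w w] equals -1, contradicting [z_ge]. *)
  have sR : - (sesq rho w w + 1) / z \is Num.real.
    apply: rpredM; last by rewrite rpredV.
    by rewrite rpredN rpredD ?rpred1 ?(ger0_real q_ge0).
  have := z_ge _ sR.
  by rewrite divfK // opprD addrAC addNr add0r oppr_ge0 ler10.
(* [t = 1] gives [b + c = 0], and [t = 'i] gives [b - c = 0]. *)
have e1 := z0 1; have e2 := z0 'i.
rewrite mul1r conjC1 mul1r in e1; rewrite conjCi in e2.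
have cb : c = - b by apply/eqP; rewrite -addr_eq0 addrC e1.
have b0 : b = 0.
  move: e2; rewrite cb mulNr mulrN opprK -mulr2n -mulrnAr => /eqP.
  by rewrite mulf_eq0 (negbTE (neq0Ci _)) /= mulrn_eq0 /= => /eqP.
by rewrite cb b0 oppr0.
Qed.

Definition ket (T : finType) (x : T) : T -> C := fun y => (y == x)%:R.

Lemma sum_ketr (T : finType) (x : T) (F : T -> C) : \sum_y F y * (y == x)%:R = F x.
Proof.
rewrite (bigD1 x) //= eqxx mulr1 big1 ?addr0 // => y /negbTE ->.
by rewrite mulr0.
Qed.

Lemma sum_ketl (T : finType) (x : T) (F : T -> C) : \sum_y (y == x)%:R^* * F y = F x.
Proof.
rewrite (bigD1 x) //= eqxx conjC1 mul1r big1 ?addr0 // => y /negbTE ->.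
by rewrite conjC0 mul0r.
Qed.

Lemma sesq_prod (T U : finType) (rho : op R (T * U)%type) (u v : T -> C) (k k' : U) :
  sesq rho (fun p => u p.1 * (p.2 == k)%:R) (fun p => v p.1 * (p.2 == k')%:R) =
  sesq (fun x y => rho (x, k) (y, k')) u v.
Proof.
rewrite /sesq sum_pair; apply: eq_bigr => x _ /=.
transitivity (\sum_l (l == k)%:R^* *
    \sum_y (u x)^* * rho (x, l) (y, k') * v y); last by rewrite sum_ketl.
apply: eq_bigr => l _; rewrite sum_pair mulr_sumr; apply: eq_bigr => y _ /=.
rewrite -(sum_ketr k' (fun l' => _ * (_ * rho (x, l) (y, l') * v y))).
by apply: eq_bigr => l' _; rewrite rmorphM; ring.
Qed.

(** For [u] orthogonal to [b], the values at [u] of the diagonal blocks are nonnegative and sum to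
    [|<u|b>|^2 = 0]. By [psd_isotropic] every block then vanishes against [u] on either side, so
    every block is a multiple of [b b^H]. *)
Lemma pure_marginal (T U : finType) (rho : op R (T * U)%type) (b : T -> C) :
  psd rho -> (forall x y, \sum_k rho (x, k) (y, k) = b x * (b y)^*) ->
  \sum_x b x * (b x)^* != 0 ->
  exists s, forall x y k k', rho (x, k) (y, k') = b x * (b y)^* * s k k'.
Proof.
move=> rho_ge0 mrho; set N := \sum_x _ => N0.
have ortho u : \sum_x (u x)^* * b x = 0 -> forall w k k',
    sesq (fun x y => rho (x, k) (y, k')) w u = 0 /\
    sesq (fun x y => rho (x, k) (y, k')) u w = 0.
  move=> ub.
  have q0 k : sesq (fun x y => rho (x, k) (y, k)) u u = 0.
    have : \sum_k sesq (fun x y => rho (x, k) (y, k)) u u = 0.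
      rewrite exchange_big; transitivity (\sum_x (u x)^* * b x * \sum_y (b y)^* * u y).
        apply: eq_bigr => x _; rewrite exchange_big mulr_sumr.
        apply: eq_bigr => y _ /=; rewrite -mulr_suml -mulr_sumr mrho; ring.
      by rewrite -mulr_suml ub mul0r.
    move/eqP; rewrite psumr_eq0 => [/allP/(_ k (mem_index_enum _))/eqP //|l _].
    by rewrite -sesq_prod; apply: rho_ge0.
  move=> w k k'.
  have [_ hr] := psd_isotropic (fun p => w p.1 * (p.2 == k')%:R) rho_ge0
                 (etrans (sesq_prod rho u u k k) (q0 k)).
  have [hl _] := psd_isotropic (fun p => w p.1 * (p.2 == k)%:R) rho_ge0
                 (etrans (sesq_prod rho u u k' k') (q0 k')).
  by rewrite !sesq_prod in hl hr.
(* A block [s b b^H] takes the value [s N^2] at [b], hence the normalisation. *)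
pose s k k' := sesq (fun x y => rho (x, k) (y, k')) b b / N ^+ 2.
exists s => x y k k'.
pose X : op R T := fun x y => rho (x, k) (y, k').
(* [N] times the projection of [ket z] onto the orthogonal complement of [b]. *)
pose u z : T -> C := fun x => - (b z)^* * b x + N * ket z x.
have NR : N^* = N.
  by apply/CrealP/ger0_real/sumr_ge0 => l _; apply: mul_conjC_ge0.
have uo z : \sum_x (u z x)^* * b x = 0.
  transitivity (\sum_x (- b z * (b x * (b x)^*) + N * ((x == z)%:R^* * b x))).
    apply: eq_bigr => l _; rewrite /u /ket rmorphD !rmorphM /= rmorphN /= NR conjCK.
    ring.
  rewrite big_split /= -!mulr_sumr sum_ketl -/N; ring.
have [h1 _] := ortho _ (uo y) (ket x) k k'.
have [_ h2] := ortho _ (uo x) b k k'.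
have kk z z' : sesq X (ket z) (ket z') = X z z'.
  rewrite /sesq /ket.
  transitivity (\sum_l (l == z)%:R^* * X l z'); last by rewrite sum_ketl.
  by apply: eq_bigr => l _; rewrite sum_ketr.
move: h1 h2; rewrite sesq_linr sesq_linl rmorphN /= conjCK NR -/X kk.
set A := sesq X (ket x) b => h1 h2.
have eA : N * A = b x * sesq X b b.
  by apply/eqP; rewrite -subr_eq0 -h2; apply/eqP; ring.
have eX : N * X x y = (b y)^* * A.
  by apply/eqP; rewrite -subr_eq0 -h1; apply/eqP; ring.
rewrite -/(X x y) /s -/X mulrA; apply: (canRL (mulfK _)); first by rewrite expf_neq0.
by rewrite expr2 mulrCA (mulrC (X x y)) eX mulrCA eA mulrCA mulrA.
Qed.

(** * Channels acting on one part of a pure state *)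

Section Channel.
Variables (P Q : finType) (Phi : op R P -> op R Q).
Hypothesis Phi_chan : channel Phi.

Lemma channel_lin (c : C) (rho sigma : op R P) y y' :
  Phi (fun x x' => c * rho x x' + sigma x x') y y' =
  c * Phi rho y y' + Phi sigma y y'.
Proof. by case: Phi_chan. Qed.

Lemma channel0 y y' : Phi (fun _ _ => 0) y y' = 0.
Proof.
have /esym/eqP := channel_lin 1 (fun _ _ => 0) (fun _ _ => 0) y y'.
have -> : (fun x x' : P => 1 * 0 + 0) = (fun _ _ => 0) :> op R P.
  by do 2!apply/funext=> ?; rewrite mulr0 addr0.
by rewrite mul1r -subr_eq0 addrK => /eqP.
Qed.

Lemma channelZ (c : C) (rho : op R P) y y' :
  Phi (fun x x' => c * rho x x') y y' = c * Phi rho y y'.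
Proof.
rewrite -[RHS]addr0 -(channel0 y y') -channel_lin; congr (Phi _ _ _).
by do 2!apply/funext=> ?; rewrite addr0.
Qed.

Lemma channelD (rho sigma : op R P) y y' :
  Phi (fun x x' => rho x x' + sigma x x') y y' = Phi rho y y' + Phi sigma y y'.
Proof.
rewrite -[Phi rho y y']mul1r -channel_lin; congr (Phi _ _ _).
by do 2!apply/funext=> ?; rewrite mul1r.
Qed.

Lemma channel_sum (F : finType) (rho : F -> op R P) y y' :
  Phi (fun x x' => \sum_f rho f x x') y y' = \sum_f Phi (rho f) y y'.
Proof.
elim: (index_enum F) => [|f r IH].
  rewrite big_nil -[RHS](channel0 y y'); congr (Phi _ _ _).
  by do 2!apply/funext=> ?; rewrite big_nil.
rewrite big_cons -IH -channelD; congr (Phi _ _ _).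
by do 2!apply/funext=> ?; rewrite big_cons.
Qed.

(* The channel acts on [P], leaving the environment [E] and the erased system
   [F] alone: complete positivity is applied to the reference [E * F]. *)
Lemma channel_pure_output (E F : finType) (psi : P -> E -> F -> C)
    (b : Q -> E -> C) :
  (forall y y' e e', Phi (fun x x' => \sum_f psi x e f * (psi x' e' f)^*) y y' =
     b y e * (b y' e')^*) ->
  \sum_y \sum_e b y e * (b y e)^* != 0 ->
  exists s, forall y y' e e' f f',
    Phi (fun x x' => psi x e f * (psi x' e' f')^*) y y' =
    b y e * (b y' e')^* * s f f'.
Proof.
move=> hb b0.
pose m := #|{: E * F}|.
pose rho : op R (P * 'I_m)%type := fun p q =>
  psi p.1 (enum_val p.2).1 (enum_val p.2).2 *
  (psi q.1 (enum_val q.2).1 (enum_val q.2).2)^*.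
have rho_ge0 : psd rho.
  move=> v; rewrite [X in 0 <= X](_ : _ =
    (\sum_p (v p)^* * psi p.1 (enum_val p.2).1 (enum_val p.2).2) *
    (\sum_p (v p)^* * psi p.1 (enum_val p.2).1 (enum_val p.2).2)^*).
    exact: mul_conjC_ge0.
  rewrite mulr_suml; apply: eq_bigr => p _; rewrite rmorph_sum mulr_sumr.
  by apply: eq_bigr => q _; rewrite rmorphM /= conjCK /rho; ring.
have [_ Phi_cp _] := Phi_chan.
have := Phi_cp _ _ rho_ge0; set om := ampl _ _ => om_ge0.
(* The reference system of [ampl] is an ordinal, so [E * F] enters through its enumeration. [g]
   regroups the output so that the marginal on [Q * E], with [F] traced out, can be compared with
   [b]. *)
pose g (p : (Q * E * F)%type) : (Q * 'I_m)%type := (p.1.1, enum_rank (p.1.2, p.2)).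
pose om' : op R ((Q * E) * F)%type := fun p q => om (g p) (g q).
have om'E y y' e e' f f' : om' (y, e, f) (y', e', f') =
    Phi (fun x x' => psi x e f * (psi x' e' f')^*) y y'.
  by rewrite /om' /om /ampl /rho /= !enum_rankK.
have om'_ge0 : psd om'.
  pose g' (q : (Q * 'I_m)%type) := (q.1, (enum_val q.2).1, (enum_val q.2).2).
  have gK : cancel g g'.
    by move=> [[y e] f]; rewrite /g' /= enum_rankK.
  have Kg : cancel g' g.
    by move=> [y k]; rewrite /g /= -surjective_pairing enum_valK.
  move=> v.
  have := om_ge0 (fun q => v (g' q)).
  rewrite (reindex g); last by exists g' => ? _.
  under eq_bigr => p _.
    rewrite (reindex g); last by exists g' => ? _.
    under eq_bigr => q _ do rewrite !gK.
    over.
  by [].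
have [||s hs] := @pure_marginal _ _ om' (fun p => b p.1 p.2) om'_ge0.
- move=> [y e] [y' e'] /=; rewrite -hb channel_sum.
  by apply: eq_bigr => f _; rewrite om'E.
- by rewrite sum_pair.
by exists s => y y' e e' f f'; rewrite -om'E hs.
Qed.

End Channel.
End Product.

(** * Independence of the code state *)

Section Uniform.
Variable C : numClosedFieldType.

Definition sqn D (u : 'rV[C]_D) : C := \sum_j u 0 j * (u 0 j)^*.

Lemma sqn_eq0 D (u : 'rV[C]_D) : (sqn u == 0) = (u == 0).
Proof.
rewrite /sqn psumr_eq0 => [|j _]; last exact: mul_conjC_ge0.
apply/allP/eqP => [h|-> j _]; last by rewrite mxE mul0r eqxx.
apply/rowP => j; have := h j (mem_index_enum _).
by rewrite -normCK expf_eq0 /= normr_eq0 mxE => /eqP.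
Qed.

Lemma sqnZ D (c : C) (u : 'rV[C]_D) : sqn (c *: u) = c * c^* * sqn u.
Proof.
rewrite /sqn mulr_sumr; apply: eq_bigr => j _; rewrite !mxE rmorphM /=; ring.
Qed.

(** Some column [w] of [cokermx v] defines a linear functional that vanishes on [v] but not on [u].
    It takes the same value [a] at [u], [u + v] and [u - v], so contracting the identity with [w]
    and its conjugate leaves [|a|^2] times the claim. *)
Lemma parallelogram_rank1 D (u v : 'rV[C]_D) (s1 s2 su sv : C) :
  ~~ (u <= v)%MS ->
  (forall i j, (u + v) 0 i * ((u + v) 0 j)^* * s1 +
               (u - v) 0 i * ((u - v) 0 j)^* * s2 =
     (u 0 i * (u 0 j)^* * su + v 0 i * (v 0 j)^* * sv) *+ 2) ->
  s1 + s2 = su *+ 2.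
Proof.
rewrite submxE => /rV0Pn[l ul] huv.
have vl : (v *m cokermx v) 0 l = 0 by rewrite mulmx_coker mxE.
rewrite mxE in ul; rewrite mxE in vl; move: ul vl.
pose w i := cokermx v i l.
pose a := \sum_i u 0 i * w i; rewrite -/a => a0 v0.
have con (x y : 'rV[C]_D) s : \sum_i \sum_j w i * (w j)^* * (x 0 i * (y 0 j)^* * s) =
    (\sum_i x 0 i * w i) * (\sum_i y 0 i * w i)^* * s.
  rewrite -mulrA mulr_suml; apply: eq_bigr => i _.
  rewrite rmorph_sum /= mulr_suml mulr_sumr; apply: eq_bigr => j _.
  by rewrite rmorphM /=; ring.
have eD b : \sum_i (u + b *: v) 0 i * w i = a.
  transitivity (a + b * \sum_i v 0 i * w i); last by rewrite v0 mulr0 addr0.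
  rewrite mulr_sumr -big_split /=.
  by apply: eq_bigr => i _; rewrite mxE [(b *: v) _ _]mxE; ring.
have e1 : \sum_i (u + v) 0 i * w i = a by rewrite -(eD 1) scale1r.
have e2 : \sum_i (u - v) 0 i * w i = a by rewrite -(eD (-1)) scaleN1r.
have : a * a^* * (s1 + s2) = a * a^* * (su *+ 2).
  rewrite mulrDr -{1 2}e1 -{1 2}e2 -!con -big_split /=.
  transitivity ((\sum_i \sum_j w i * (w j)^* * (u 0 i * (u 0 j)^* * su) +
      \sum_i \sum_j w i * (w j)^* * (v 0 i * (v 0 j)^* * sv)) *+ 2).
    rewrite -big_split -sumrMnl /=; apply: eq_bigr => i _.
    rewrite -!big_split -sumrMnl /=; apply: eq_bigr => j _ /=.
    by rewrite -!mulrDr -mulrnAr -huv mulrDr.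
  by rewrite !con v0 mul0r mul0r addr0 mulrnAr.
by apply: mulfI; rewrite mulf_neq0 // conjC_eq0.
Qed.

End Uniform.

Section UniformOutput.
Variables (R : realType) (P Q E F : finType) (Phi : op R P -> op R Q).
Hypothesis Phi_chan : channel Phi.
Variables (m D : nat) (V : 'M[R[i]]_(m, D)).
(** Coordinates of a code vector are read in two ways: [h] assembles one from the channel input, a
    bystander [E] and the erased part [F], and [g] from the channel output and the bystander. *)
Variables (h : P -> E -> F -> 'I_D) (g : Q -> E -> 'I_D).
Hypothesis g_surj : forall j, exists y e, g y e = j.

Local Notation out u e f e' f' :=
  (Phi (fun x x' => u 0 (h x e f) * (u 0 (h x' e' f'))^*)).

Lemma outZ (c : R[i]) (u : 'rV[R[i]]_D) e f e' f' y y' :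
  out (c *: u) e f e' f' y y' = c * c^* * out u e f e' f' y y'.
Proof.
rewrite -channelZ //; congr (Phi _ _ _).
by do 2!apply/funext=> ?; rewrite !mxE rmorphM /=; ring.
Qed.

Lemma out_parallelogram (u v : 'rV[R[i]]_D) e f e' f' y y' :
  out (u + v) e f e' f' y y' + out (u - v) e f e' f' y y' =
  (out u e f e' f' y y' + out v e f e' f' y y') *+ 2.
Proof.
rewrite mulr2n -!channelD //; congr (Phi _ _ _).
by do 2!apply/funext=> ?; rewrite !mxE rmorphD rmorphB /=; ring.
Qed.

(** [channel_pure_output] yields a factor for each nonzero [u] separately. Factors of proportional
    vectors agree by homogeneity; for independent [u] and [u0], the parallelogram identity makes
    twice either factor equal to the sum of those of [u + u0] and [u - u0]. *)
Lemma channel_uniform_output :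
  (forall u : 'rV_D, (u <= V)%MS -> sqn u = 1 -> forall y y' e e',
     Phi (fun x x' => \sum_f u 0 (h x e f) * (u 0 (h x' e' f))^*) y y' =
     u 0 (g y e) * (u 0 (g y' e'))^*) ->
  V != 0 ->
  exists s, forall u : 'rV_D, (u <= V)%MS -> forall y y' e e' f f',
    out u e f e' f' y y' = u 0 (g y e) * (u 0 (g y' e'))^* * s f f'.
Proof.
move=> hPhi V0.
have hs (u : 'rV_D) : (u <= V)%MS -> u != 0 -> exists s, forall y y' e e' f f',
    out u e f e' f' y y' = u 0 (g y e) * (u 0 (g y' e'))^* * s f f'.
  move=> uV u0.
  apply: (channel_pure_output Phi_chan (psi := fun x e f => u 0 (h x e f))
            (b := fun y e => u 0 (g y e))) => [y y' e e'|].
    have N0 : sqn u != 0 by rewrite sqn_eq0.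
    (* The hypothesis covers unit vectors only, so [u] is divided by its norm [c]. *)
    pose c := sqrtC (sqn u).
    have c0 : c != 0 by rewrite sqrtC_eq0.
    have N_ge0 : 0 <= sqn u by apply: sumr_ge0 => j _; apply: mul_conjC_ge0.
    have cR : c^* = c by apply/CrealP/ger0_real; rewrite sqrtC_ge0.
    have cc : c * c = sqn u by rewrite -expr2 sqrtCK.
    have n1 : sqn (c^-1 *: u) = 1.
      by rewrite sqnZ fmorphV /= cR -invfM cc mulVf.
    have := hPhi _ (scalemx_sub _ uV) n1 y y' e e'.
    rewrite !channel_sum // !mxE.
    under eq_bigr => f _ do rewrite outZ.
    rewrite -mulr_sumr rmorphM fmorphV /= cR => hh.
    have ic0 : c^-1 * c^-1 != 0 by rewrite mulf_neq0 ?invr_eq0.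
    by apply: (mulfI ic0); rewrite hh fmorphV /= cR; ring.
  (* Surjectivity of [g] brings a nonzero coordinate of [u] into the sum of squared moduli. *)
  have /rV0Pn[j uj] := u0.
  have [y [e ge]] := g_surj j.
  apply/eqP => /psumr_eq0P-/(_ _ y isT) S0.
  have /S0/psumr_eq0P-/(_ _ e isT) : forall y, true ->
      0 <= \sum_e u 0 (g y e) * (u 0 (g y e))^*.
    by move=> ? _; apply: sumr_ge0 => ? _; apply: mul_conjC_ge0.
  move=> /(_ (fun _ _ => mul_conjC_ge0 _))/eqP.
  by rewrite ge -normCK expf_eq0 /= normr_eq0 (negbTE uj).
have /rowV0Pn[u0 u0V u00] := V0.
have [s0 hs0] := hs u0 u0V u00.
exists s0 => u uV y y' e e' f f'.
have [->|un0] := eqVneq u 0.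
  by have := outZ 0 0 e f e' f' y y'; rewrite scale0r => ->; rewrite !mxE !mul0r.
have [s hsu] := hs u uV un0; rewrite hsu; congr (_ * _).
have [/sub_rVP[c uc]|uNu0] := boolP (u <= u0)%MS.
  have /rV0Pn[j uj] := un0.
  have [y1 [e1 ge]] := g_surj j.
  have hh := outZ c u0 e1 f e1 f' y1 y1; rewrite -uc hs0 hsu ge in hh.
  have n0 : u 0 j * (u 0 j)^* != 0 by rewrite mulf_neq0 ?conjC_eq0.
  by apply: (mulfI n0); rewrite hh uc !mxE rmorphM /=; ring.
have u0Nu : ~~ (u0 <= u)%MS.
  apply: contra uNu0 => /sub_rVP[c uc]; apply/sub_rVP; exists c^-1.
  have c0 : c != 0 by apply: contraNneq u00 => c0; rewrite uc c0 scale0r.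
  by rewrite uc scalerA mulVf ?scale1r.
have [|s1 hs1] := hs (u + u0) (addmx_sub uV u0V).
  rewrite addr_eq0; apply: contraNneq uNu0 => ->.
  by rewrite eqmx_opp.
have umV : (u - u0 <= V)%MS by rewrite addmx_sub ?eqmx_opp.
have [|s2 hs2] := hs (u - u0) umV.
  by rewrite subr_eq0; apply: contraNneq uNu0 => ->.
have par i j : (u + u0) 0 i * ((u + u0) 0 j)^* * s1 f f' +
    (u - u0) 0 i * ((u - u0) 0 j)^* * s2 f f' =
    (u 0 i * (u 0 j)^* * s f f' + u0 0 i * (u0 0 j)^* * s0 f f') *+ 2.
  have [y1 [e1 <-]] := g_surj i; have [y2 [e2 <-]] := g_surj j.
  by rewrite -hs1 -hs2 -hsu -hs0 out_parallelogram.
have r1 := parallelogram_rank1 uNu0 par.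
(* The roles of [u] and [u0] are exchanged; the sign change of [u - u0] cancels in the products. *)
have : s1 f f' + s2 f f' = s0 f f' *+ 2.
  apply: (parallelogram_rank1 u0Nu (sv := s f f')) => i j.
  rewrite [RHS](_ : _ = (u 0 i * (u 0 j)^* * s f f' +
    u0 0 i * (u0 0 j)^* * s0 f f') *+ 2); last by rewrite addrC.
  by rewrite -par addrC !mxE !rmorphD !rmorphN /=; ring.
rewrite r1 => /eqP; rewrite -subr_eq0 -mulrnBl mulrn_eq0 subr_eq0 => /eqP //.
Qed.

(** Taking the trace over [Q] in [channel_uniform_output] eliminates the channel, by trace
    preservation. *)
Lemma channel_reduced_state :
  (forall u : 'rV_D, (u <= V)%MS -> sqn u = 1 -> forall y y' e e',
     Phi (fun x x' => \sum_f u 0 (h x e f) * (u 0 (h x' e' f))^*) y y' =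
     u 0 (g y e) * (u 0 (g y' e'))^*) ->
  V != 0 ->
  exists s, forall u : 'rV_D, (u <= V)%MS -> forall e e' f f',
    \sum_x u 0 (h x e f) * (u 0 (h x e' f'))^* =
    (\sum_y u 0 (g y e) * (u 0 (g y e'))^*) * s f f'.
Proof.
move=> hPhi /(channel_uniform_output hPhi)[s hs]; exists s => u uV e e' f f'.
have [_ _ /(_ (fun x x' => u 0 (h x e f) * (u 0 (h x' e' f'))^*))] := Phi_chan.
rewrite /trace => <-; rewrite mulr_suml; apply: eq_bigr => y _; exact: hs.
Qed.

End UniformOutput.

(** * Configurations on disjoint sets of qudits *)

Section Overlay.
Variables (n a : nat) (o : 'I_a).
Local Notation raw := {ffun 'I_n -> option 'I_a}.
Implicit Types (A B D E : {set 'I_n}) (x y z : raw).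

(** Configurations on different sets have different types, so they are juxtaposed and restricted as
    underlying partial maps and packed again by [mk]. *)
Definition overlay x y : raw := [ffun j => if x j is Some v then Some v else y j].
Definition restr B x : raw := [ffun j => if j \in B then x j else None].
Definition dom x : {set 'I_n} := [set j | isSome (x j)].

Lemma dom_cfg B (x : cfg a B) : dom (val x) = B.
Proof.
by apply/setP => j; rewrite inE; have /forallP/(_ j)/eqP := valP x.
Qed.

Lemma cfg_isSome B (x : cfg a B) j : isSome (val x j) = (j \in B).
Proof. by have /forallP/(_ j)/eqP := valP x. Qed.

Lemma dom_overlay x y : dom (overlay x y) = dom x :|: dom y.
Proof. by apply/setP => j; rewrite !inE ffunE; case: (x j). Qed.

Lemma dom_restr B x : B \subset dom x -> dom (restr B x) = B.
Proof.
move=> /subsetP sB; apply/setP => j; rewrite !inE ffunE.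
by have := sB j; rewrite inE; case: (j \in B) => // ->.
Qed.

Lemma overlayC x y : [disjoint dom x & dom y] -> overlay x y = overlay y x.
Proof.
move=> /pred0P dxy; apply/ffunP => j; rewrite !ffunE; have := dxy j.
by rewrite !inE; case: (x j); case: (y j).
Qed.

Lemma overlayA x y z : overlay (overlay x y) z = overlay x (overlay y z).
Proof. by apply/ffunP => j; rewrite !ffunE; case: (x j). Qed.

Lemma restr_overlayl B (x : cfg a B) y : restr B (overlay (val x) y) = val x.
Proof.
by apply/ffunP => j; rewrite !ffunE -(cfg_isSome x); case: (val x j).
Qed.

Lemma restr_overlayr B E (x : cfg a B) (y : cfg a E) :
  [disjoint B & E] -> restr E (overlay (val x) (val y)) = val y.
Proof. by move=> dBE; rewrite overlayC ?dom_cfg // restr_overlayl. Qed.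

Lemma overlay_restr B E x : dom x = B :|: E -> overlay (restr B x) (restr E x) = x.
Proof.
move=> dx; apply/ffunP => j; rewrite !ffunE.
have : (j \in dom x) = (j \in B :|: E) by rewrite dx.
rewrite !inE; case: (j \in B); case: (j \in E); case: (x j) => //.
Qed.

Definition cfg0 B : cfg a B.
Proof.
exists [ffun j => if j \in B then Some o else None].
by apply/forallP => j; rewrite ffunE; case: (j \in B).
Defined.

(** Unless [dom x = B], the result is the filler [cfg0 B]; the symbol [o] serves only to build that
    filler. *)
Definition mk B x : cfg a B := insubd (cfg0 B) x.

Lemma val_mk B x : dom x = B -> val (mk B x) = x.
Proof.
by move=> <-; apply: insubdK; apply/forallP => j; rewrite inE.
Qed.

Lemma mk_val B (x : cfg a B) : mk B (val x) = x.
Proof. exact: valKd. Qed.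

Lemma card_cfg B : #|cfg a B| = (a ^ #|B|)%N.
Proof.
rewrite card_sig.
have -> : #|[pred x : raw | [forall i, (i \in B) == isSome (x i)]]| =
    #|pffun_on (None : option 'I_a) (mem B) (predC1 None)|.
  apply: eq_card => x; rewrite [LHS]inE; apply/forallP/pffun_onP.
    move=> h; split.
      by apply/supportP => j jB; have := h j; rewrite (negbTE jB); case: (x j).
    by move=> _ /imageP[j jB ->]; have := h j; rewrite jB inE; case: (x j).
  move=> [/supportP h1 h2] j; case: (boolP (j \in B)) => jB.
    by have := h2 (x j) (image_f _ jB); rewrite inE; case: (x j).
  by rewrite h1.
by rewrite card_pffun_on cardC1 card_option card_ord.
Qed.

(** Turns the relation [glue] into the graph of a function, so that the guarded sums in [ptr] and
    [apply_id] collapse to single terms. *)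
Lemma glueE D B E (w : cfg a D) (y : cfg a B) (e : cfg a E) :
  D = B :|: E -> glue w y e = (w == mk D (overlay (val y) (val e))).
Proof.
move=> hD; rewrite -val_eqE /= val_mk; last by rewrite dom_overlay !dom_cfg.
have -> : overlay (val y) (val e) = [ffun j => if j \in B then val y j else val e j].
  by apply/ffunP => j; rewrite !ffunE -(cfg_isSome y); case: (val y j).
apply/forallP/eqP => [h|h j]; last first.
  by rewrite (h : val w = _) ffunE.
by apply/ffunP => j; rewrite ffunE; apply/eqP.
Qed.

Lemma mk_overlay_inj D B E (y y' : cfg a B) (e e' : cfg a E) :
  D = B :|: E -> [disjoint B & E] ->
  (mk D (overlay (val y) (val e)) == mk D (overlay (val y') (val e'))) =
  (y == y') && (e == e').
Proof.
move=> hD dBE; apply/eqP/andP => [/(congr1 val)|[/eqP-> /eqP->]] //.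
rewrite !val_mk ?dom_overlay ?dom_cfg // => h; split; apply/eqP/val_inj.
  by rewrite -(restr_overlayl y (val e)) h restr_overlayl.
by rewrite -(restr_overlayr y e dBE) h restr_overlayr.
Qed.

Lemma cfg_split D B E (w : cfg a D) : D = B :|: E ->
  exists (y : cfg a B) (e : cfg a E), overlay (val y) (val e) = val w.
Proof.
move=> hD; exists (mk B (restr B (val w))), (mk E (restr E (val w))).
by rewrite !val_mk ?overlay_restr ?dom_restr ?dom_cfg ?hD ?subsetUl ?subsetUr.
Qed.

Lemma sum_cfg_split (M : nmodType) D B E (G : raw -> M) :
  D = B :|: E -> [disjoint B & E] ->
  \sum_(w : cfg a D) G (val w) =
  \sum_(y : cfg a B) \sum_(e : cfg a E) G (overlay (val y) (val e)).
Proof.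
move=> hD dBE; rewrite pair_bigA /=.
rewrite (reindex (fun p : cfg a B * cfg a E =>
  mk D (overlay (val p.1) (val p.2)))%type) /=.
  by apply: eq_bigr => p _; rewrite val_mk // dom_overlay !dom_cfg.
exists (fun w => (mk B (restr B (val w)), mk E (restr E (val w)))) => [[y e] _|w _] /=.
  have dye : dom (overlay (val y) (val e)) = D by rewrite dom_overlay !dom_cfg.
  by rewrite (val_mk dye) restr_overlayl restr_overlayr // !mk_val.
by rewrite !val_mk ?overlay_restr ?mk_val ?dom_restr ?dom_cfg ?hD ?subsetUl ?subsetUr.
Qed.

End Overlay.

(** * Correctable sets *)

Section Code.
Variables (R : realType) (n a : nat) (o : 'I_a).
Local Notation C := R[i].
Local Notation raw := {ffun 'I_n -> option 'I_a}.
Implicit Types (A B D E S I : {set 'I_n}).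

Lemma ptrE A B (rho : op R (cfg a A)) (x x' : cfg a B) : B \subset A ->
  ptr rho x x' = \sum_(z : cfg a (A :\: B))
    rho (mk o A (overlay (val x) (val z))) (mk o A (overlay (val x') (val z))).
Proof.
move=> sBA; apply: eq_bigr => z _.
have hA : A = B :|: (A :\: B) by rewrite setDE setUIr setUCr setIT (setUidPr sBA).
rewrite -(sum_if_pair _ _ rho).
apply: eq_bigr => w _; apply: eq_bigr => w' _.
by rewrite !(glueE o _ _ _ hA).
Qed.

Lemma apply_idE A B E D D' (Phi : op R (cfg a A) -> op R (cfg a B))
    (rho : op R (cfg a D)) (y y' : cfg a B) (e e' : cfg a E) :
  [disjoint B & E] -> D' = B :|: E -> D = A :|: E ->
  @apply_id R n a A B E D D' Phi rho (mk o D' (overlay (val y) (val e)))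
    (mk o D' (overlay (val y') (val e'))) =
  Phi (fun x x' => rho (mk o D (overlay (val x) (val e)))
                       (mk o D (overlay (val x') (val e')))) y y'.
Proof.
move=> dBE hD' hD; rewrite /apply_id; set K := RHS.
transitivity (\sum_y1 \sum_y1' \sum_e1 \sum_e1'
  (if (y1 == y) && (y1' == y') then
    (if (e1 == e) && (e1' == e') then
     K else 0) else 0)).
  apply: eq_bigr => y1 _; apply: eq_bigr => y1' _.
  apply: eq_bigr => e1 _; apply: eq_bigr => e1' _.
  rewrite !(glueE o _ _ _ hD') !mk_overlay_inj //.
  rewrite !(eq_sym y) !(eq_sym y') !(eq_sym e) !(eq_sym e').
  have [->|] := eqVneq y1 y; have [->|] := eqVneq y1' y';
  have [->|] := eqVneq e1 e; have [->|] := eqVneq e1' e'; rewrite /= ?andbF //.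
  rewrite /K; congr (Phi _ _ _); do 2!apply/funext => ?.
  rewrite -(sum_if_pair _ _ rho).
  apply: eq_bigr => w _; apply: eq_bigr => w' _.
  by rewrite !(glueE o _ _ _ hD).
rewrite -[RHS](sum_if_pair y y' (fun _ _ => K)).
apply: eq_bigr => y1 _; apply: eq_bigr => y1' _.
case: ifP => _; last by rewrite big1 // => ? _; rewrite big1.
exact: (sum_if_pair e e' (fun _ _ => K)).
Qed.

Definition idx (x : raw) : 'I_(dimH n a) := enum_rank (mk o [set: 'I_n] x).

Lemma sum_idx (G : 'I_(dimH n a) -> C) :
  \sum_(w : cfg a [set: 'I_n]) G (idx (val w)) = \sum_j G j.
Proof.
rewrite [RHS](reindex (@enum_rank (cfgT n a))) /=; last first.
  by exists enum_val => ? _; rewrite ?enum_rankK ?enum_valK.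
by apply: eq_bigr => w _; rewrite /idx mk_val.
Qed.

(** The partial trace of [|u><v|] over the complement of [A], without normalisation. *)
Definition reduced A (u v : 'rV[C]_(dimH n a)) : op R (cfg a A) := fun x x' =>
  \sum_(z : cfg a (~: A)) u 0 (idx (overlay (val x) (val z))) *
                          (v 0 (idx (overlay (val x') (val z))))^*.

Section Correctable.
Variables (m : nat) (V : 'M[C]_(m, dimH n a)).

(** Only equal pairs [u, u] are constrained; [polarization] recovers the mixed products. *)
Definition correctable A := exists s : op R (cfg a A), forall u : 'rV_(dimH n a),
  (u <= V)%MS -> forall x x', reduced u u x x' = sqn u * s x x'.

End Correctable.

Variable (V : 'M[C]_(dimH n a)).
Hypothesis V_neq0 : V != 0.

Lemma decodes_correctable S : decodes V S -> correctable V S.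
Proof.
move=> [Dec [chan hDec]].
(* The decoder acts on all surviving qudits, so the bystander is trivial. *)
pose h (x : cfg a (~: S)) (_ : unit) (f : cfg a S) := idx (overlay (val x) (val f)).
pose g (y : cfgT n a) (_ : unit) := enum_rank y.
have g_surj j : exists y e, g y e = j.
  by exists (enum_val j), tt; rewrite /g enum_valK.
have [|s hs] := channel_reduced_state chan (h := h) g_surj _ V_neq0.
  move=> u uV u1 y y' [] []; rewrite -[RHS](hDec u _ y y') //.
  congr (Dec _ _ _); do 2!apply/funext => ?.
  rewrite ptrE ?subsetT // setTD setCK.
  by apply: eq_bigr.
exists s => u uV x x'.
have := hs u uV tt tt x x'.
have -> : \sum_y u 0 (g y tt) * (u 0 (g y tt))^* = sqn u.
  rewrite -[RHS](sum_idx (fun j => u 0 j * (u 0 j)^*)).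
  by apply: eq_bigr => y _; rewrite /idx mk_val.
move=> <-; apply: eq_bigr => z _; rewrite /h.
by rewrite ![overlay (val z) _]overlayC ?dom_cfg // ?disjoints_subset ?subxx.
Qed.

(** Here the bystander is [~: I] and the erased part is the qudit [i]: the reduced state on [i] and
    [~: I] together is a product, with a factor on [i] that is independent of the code state. *)
Lemma local_recovery_reduced I i (Rec : op R (cfg a (I :\ i)) -> op R (cfg a I)) :
  i \in I -> channel Rec ->
  (forall psi, code_state V psi -> forall x x',
     @apply_id R n a (I :\ i) I (~: I) (~: [set i]) [set: 'I_n] Rec
       (@ptr R n a [set: 'I_n] (~: [set i]) (pure psi)) x x' = pure psi x x') ->
  exists s : op R (cfg a [set i]), forall u : 'rV_(dimH n a), (u <= V)%MS ->
    forall (e e' : cfg a (~: I)) f f',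
    \sum_(x : cfg a (I :\ i))
      u 0 (idx (overlay (overlay (val x) (val e)) (val f))) *
      (u 0 (idx (overlay (overlay (val x) (val e')) (val f'))))^* =
    (\sum_(y : cfg a I) u 0 (idx (overlay (val y) (val e))) *
       (u 0 (idx (overlay (val y) (val e'))))^*) * s f f'.
Proof.
move=> iI chan hRec.
pose h (x : cfg a (I :\ i)) (e : cfg a (~: I)) (f : cfg a [set i]) :=
  idx (overlay (overlay (val x) (val e)) (val f)).
pose g (y : cfg a I) (e : cfg a (~: I)) := idx (overlay (val y) (val e)).
have hT : [set: 'I_n] = I :|: ~: I by rewrite setUCr.
have dI : [disjoint I & ~: I] by rewrite disjoints_subset setCK.
have hD : ~: [set i] = (I :\ i) :|: ~: I.
  apply/setP => j; rewrite !inE; have [->|] := eqVneq j i; last by case: (j \in I).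
  by rewrite iI.
apply: (channel_reduced_state chan (h := h) (g := g) _ _ V_neq0).
  move=> j; have [y [e ye]] := cfg_split o (enum_val j) hT.
  by exists y, e; rewrite /g ye /idx mk_val enum_valK.
move=> u uV u1 y y' e e'.
rewrite -[RHS](hRec u (conj uV u1) (mk o setT (overlay (val y) (val e)))
  (mk o setT (overlay (val y') (val e')))) apply_idE //.
congr (Rec _ _ _); do 2!apply/funext => ?.
rewrite ptrE ?subsetT // setTD setCK; apply: eq_bigr => f _.
by rewrite /pure !val_mk // dom_overlay !dom_cfg.
Qed.

Lemma correctable_add I i A :
  i \in I ->
  (exists Rec : op R (cfg a (I :\ i)) -> op R (cfg a I),
     channel Rec /\ forall psi, code_state V psi -> forall x x',
     @apply_id R n a (I :\ i) I (~: I) (~: [set i]) [set: 'I_n] Rec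
       (@ptr R n a [set: 'I_n] (~: [set i]) (pure psi)) x x' = pure psi x x') ->
  [disjoint A & I] -> correctable V A -> correctable V (i |: A).
Proof.
move=> iI [Rec [chan hRec]] dAI [sA hA].
have [s hs] := local_recovery_reduced iI chan hRec.
pose pA (x : cfg a (i |: A)) := mk o A (restr A (val x)).
pose pi (x : cfg a (i |: A)) := mk o [set i] (restr [set i] (val x)).
have px x : val x = overlay (val (pA x)) (val (pi x)).
  rewrite !val_mk ?overlay_restr ?dom_restr ?dom_cfg ?subsetUl ?subsetUr //.
  by rewrite setUC.
exists (fun x x' => sA (pA x) (pA x') * s (pi x) (pi x')) => u uV x x'.
(* Since [A] lies in [~: I], tracing [Z] out of the product state on [i] and [~: I] leaves a product
   on [i] and [A]. *)
rewrite mulrA -hA //; set Z := ~: I :\: A.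
have AI j : j \in A -> j \in I = false.
  exact: disjointFr dAI.
have hC : ~: (i |: A) = Z :|: (I :\ i).
  apply/setP => j; rewrite !inE; case: (boolP (j \in A)) => [/AI ->|_] /=.
    by rewrite !orbT andbF.
  rewrite orbF; have [->|_] := eqVneq j i; first by rewrite iI.
  by case: (j \in I).
have hZ : [disjoint Z & I :\ i].
  by apply/pred0P => j; rewrite !inE; case: (j \in I); rewrite ?andbF.
have hE : ~: I = A :|: Z.
  apply/setP => j; rewrite !inE; case: (boolP (j \in A)) => [/AI ->|_] //=.
have hCA : ~: A = Z :|: I.
  apply/setP => j; rewrite !inE; case: (boolP (j \in A)) => [/AI ->|_] //=.
  by case: (j \in I).
have dZI : [disjoint Z & I].
  by apply/pred0P => j; rewrite !inE; case: (j \in I); rewrite ?andbF.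
have dAZ : [disjoint A & Z].
  by apply/pred0P => j; rewrite !inE; case: (j \in A); rewrite ?andbF.
rewrite {1}/reduced (sum_cfg_split o (fun z => u 0 (idx (overlay (val x) z)) *
  (u 0 (idx (overlay (val x') z)))^*) hC hZ).
rewrite /reduced (sum_cfg_split o (fun z => u 0 (idx (overlay (val (pA x)) z)) *
  (u 0 (idx (overlay (val (pA x')) z)))^*) hCA dZI) mulr_suml.
apply: eq_bigr => z _.
pose e y := mk o (~: I) (overlay (val (pA y)) (val z)).
have eE y : val (e y) = overlay (val (pA y)) (val z).
  by rewrite val_mk // dom_overlay !dom_cfg hE.
(* The four pieces have disjoint domains, so at each qudit at most one is defined and the order of
   overlaying is immaterial. *)
have h1 y (p : cfg a (I :\ i)) : overlay (val y) (overlay (val z) (val p)) =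
    overlay (overlay (val p) (val (e y))) (val (pi y)).
  rewrite eE px; apply/ffunP => j; rewrite !ffunE.
  have := cfg_isSome (pA y) j; have := cfg_isSome (pi y) j.
  have := cfg_isSome z j; have := cfg_isSome p j; rewrite !inE.
  have nAI : ~~ ((j \in A) && (j \in I)).
    by apply/negP => /andP[/AI ->].
  have jiI : (j == i) ==> (j \in I) by apply/implyP => /eqP->.
  move: nAI jiI; case: (j \in A); case: (j \in I); case: (j == i) => //= _ _;
  case: (val (pA y) j); case: (val (pi y) j); case: (val z j); case: (val p j) => //.
have h2 y (p : cfg a I) : overlay (val (pA y)) (overlay (val z) (val p)) =
    overlay (val p) (val (e y)).
  by rewrite eE -overlayA overlayC // dom_overlay !dom_cfg -hE disjoints_subset subxx.
under eq_bigr => p _ do rewrite !h1.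
by rewrite hs //; under [in RHS]eq_bigr => p _ do rewrite !h2.
Qed.

End Code.

(** * The Singleton-type bound *)

(** The difference [B] of the two sides is sesquilinear and vanishes on the diagonal of the code.
    Expanding it at [u + c v] for [c = 1] and [c = 'i] gives [B u v = 0]. *)
Lemma polarization (C : numClosedFieldType) m D (V : 'M[C]_(m, D)) (T : finType)
    (f g : T -> 'I_D) (s : C) :
  (forall u : 'rV_D, (u <= V)%MS ->
     \sum_t u 0 (f t) * (u 0 (g t))^* = sqn u * s) ->
  forall u v : 'rV_D, (u <= V)%MS -> (v <= V)%MS ->
  \sum_t u 0 (f t) * (v 0 (g t))^* = (\sum_j u 0 j * (v 0 j)^*) * s.
Proof.
move=> hV u v uV vV.
pose B (x y : 'rV[C]_D) :=
  \sum_t x 0 (f t) * (y 0 (g t))^* - (\sum_j x 0 j * (y 0 j)^*) * s.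
have BV w : (w <= V)%MS -> B w w = 0 by move=> wV; rewrite /B hV ?subrr.
have BDl c x y w : B (x + c *: y) w = B x w + c * B y w.
  rewrite /B mulrBr !mulr_suml !mulr_sumr addrACA -opprD -!big_split /=.
  by congr (_ - _); apply: eq_bigr => j _; rewrite !mxE; ring.
have BDr c x y w : B w (x + c *: y) = B w x + c^* * B w y.
  rewrite /B mulrBr !mulr_suml !mulr_sumr addrACA -opprD -!big_split /=.
  by congr (_ - _); apply: eq_bigr => j _; rewrite !mxE rmorphD rmorphM /=; ring.
have Bc c : c^* * B u v + c * B v u = 0.
  rewrite -[RHS](BV (u + c *: v)) ?addmx_sub ?scalemx_sub // BDl !BDr.
  by rewrite !BV //; ring.
have e1 := Bc 1; have e2 := Bc 'i.
rewrite conjC1 !mul1r in e1; rewrite conjCi in e2.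
have Bvu : B v u = - B u v by apply/eqP; rewrite -addr_eq0 addrC e1.
have : B u v = 0.
  move: e2; rewrite Bvu mulNr mulrN -opprD -mulr2n -mulrnAr => /eqP.
  by rewrite oppr_eq0 mulf_eq0 (negbTE (neq0Ci _)) /= mulrn_eq0 /= => /eqP.
by move/eqP; rewrite subr_eq0 => /eqP.
Qed.

Section Bound.
Variables (R : realType) (n a : nat) (o : 'I_a).
Local Notation C := R[i].
Variable (V : 'M[C]_(dimH n a)).
Implicit Types (A B W : {set 'I_n}).

Lemma rank_le_of_correctable A B : [disjoint A & B] ->
  correctable o V A -> correctable o V B -> (\rank V <= a ^ #|~: (A :|: B)|)%N.
Proof.
move=> dAB [sA hA] [sB hB]; rewrite -card_cfg.
set K := \rank V; set D := ~: (A :|: B).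
pose W := row_base V.
have WV k : (row k W <= V)%MS by rewrite (submx_trans (row_sub _ _)) ?eq_row_base.
(* The basis [W] of the code need not be orthonormal; its invertible Gram matrix [G] replaces the
   identity. *)
pose G := W *m (map_mx Num.conj W)^T.
have GE k l : \sum_j row k W 0 j * (row l W 0 j)^* = G k l.
  by rewrite !mxE; apply: eq_bigr => j _; rewrite !mxE.
have Gu : G \in unitmx.
  by rewrite -row_free_unit /row_free mxrank_gram -/(row_free _) row_base_free.
have hAC : ~: A = B :|: D.
  apply/setP => j; rewrite !inE; have := disjointFr dAB (x := j).
  by case: (j \in A) => [->|] //; case: (j \in B).
have hBC : ~: B = A :|: D.
  apply/setP => j; rewrite !inE; have := disjointFr dAB (x := j).
  by case: (j \in A) => [->|] //; case: (j \in B).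
have dBD : [disjoint B & D].
  by apply/pred0P => j; rewrite !inE; case: (j \in B); rewrite ?orbT ?andbF.
have dAD : [disjoint A & D].
  by apply/pred0P => j; rewrite !inE; case: (j \in A).
have hT : [set: 'I_n] = A :|: ~: A by rewrite setUCr.
have dAA : [disjoint A & ~: A] by rewrite disjoints_subset setCK.
pose psi k (x : cfg a A) (y : cfg a B) (z : cfg a D) :=
  row k W 0 (idx o (overlay (val x) (overlay (val y) (val z)))).
apply: (@tripartite_rank _ K _ _ _ psi G sA sB Gu) => [k l|k l x x'|k l y y'].
- rewrite -GE -(sum_idx o (fun j => row k W 0 j * (row l W 0 j)^*)).
  rewrite (sum_cfg_split o (fun w =>
    row k W 0 (idx o w) * (row l W 0 (idx o w))^*) hT dAA).
  apply: eq_bigr => x _.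
  by rewrite (sum_cfg_split o (fun z => row k W 0 (idx o (overlay (val x) z)) *
    (row l W 0 (idx o (overlay (val x) z)))^*) hAC dBD).
- rewrite -GE -(polarization (fun u uV => hA u uV x x')) //.
  by rewrite (sum_cfg_split o (fun z => row k W 0 (idx o (overlay (val x) z)) *
    (row l W 0 (idx o (overlay (val x') z)))^*) hAC dBD).
rewrite -GE -(polarization (fun u uV => hB u uV y y')) //.
rewrite (sum_cfg_split o (fun z => row k W 0 (idx o (overlay (val y) z)) *
    (row l W 0 (idx o (overlay (val y') z)))^*) hBC dAD).
apply: eq_bigr => x _; apply: eq_bigr => z _; rewrite /psi.
by rewrite -!overlayA ![overlay (val x) _]overlayC ?dom_cfg // disjoint_sym.
Qed.

End Bound.

(** Guarantees that the distance is at least 1, so that [d.-1] is the true predecessor. The decoder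
    is the identity, and the partial trace runs over the single empty configuration. *)
Lemma decodes_set0 (R : realType) (n a : nat) (V : 'M[R[i]]_(dimH n a)) :
  (0 < a)%N -> decodes V set0.
Proof.
move=> a0; pose o := Ordinal a0; rewrite /decodes setC0.
exists id; split.
  split=> // m rho rho_ge0; rewrite /ampl [X in psd X](_ : _ = rho) //.
  by do 2!apply/funext=> -[? ?].
move=> psi _ x x'; rewrite (ptrE o) // setDv.
transitivity (\sum_(z : @cfg n a set0) pure psi x x').
  have ov0 (y : cfgT n a) z : mk o setT (overlay (val y) z) = y.
    rewrite -[RHS](mk_val o); congr (mk _ _ _); apply/ffunP => j.
    by rewrite ffunE; have := cfg_isSome y j; rewrite inE; case: (val y j).
  by apply: eq_bigr => z _; rewrite !ov0.
by rewrite sumr_const card_cfg cards0 expn0 mulr1n.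
Qed.

(* Greedy choice: put [i] in [B] and forbid the rest of its recovery set [I i]. *)
Lemma greedy_recoverable (n r m : nat) (P : {set 'I_n} -> Prop) (I : 'I_n -> {set 'I_n}) :
  (0 < r)%N -> (forall i, i \in I i) -> (forall i, #|I i| <= r)%N ->
  (forall D : {set 'I_n}, #|D| = m -> P D) ->
  (forall i (A : {set 'I_n}), [disjoint A & I i] -> P A -> P (i |: A)) ->
  forall (x : nat) (W : {set 'I_n}), (x * r + m <= #|W|)%N ->
  exists B : {set 'I_n}, [/\ B \subset W, #|B| = (m + x)%N & P B].
Proof.
move=> r0 iI Ir Pm Padd; elim=> [|x IH] W hW.
  have : (0 < #|[set B : {set 'I_n} | B \subset W & #|B| == m]|)%N.
    by rewrite cards_draws bin_gt0.
  case/card_gt0P => B; rewrite inE => /andP[BW /eqP cB].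
  by exists B; rewrite addn0; split => //; apply: Pm.
have [i iW] : exists i, i \in W.
  by apply/card_gt0P; move: hW; rewrite mulSn; lia.
have [|B [BW cB PB]] := IH (W :\: I i).
  have := cardsID (I i) W; have := subset_leq_card (subsetIr W (I i)).
  by have := Ir i; move: hW; rewrite mulSn; lia.
have /subsetDP[BW' dBI] := BW.
exists (i |: B); split; last exact: Padd.
  by rewrite subUset sub1set iW.
by rewrite cardsU1 cB (disjointFl dBI (iI i)) add1n addnS.
Qed.

Theorem theorem3p1 (R : realType) (n a k d r : nat)
  (V : 'M[R[i]]_(dimH n a)) :
  (2 <= a)%N -> (0 < k)%N ->
  \rank V = (a ^ k)%N ->
  is_distance V d ->
  is_qLRC V r ->
  (k%:Z <= n%:Z - 2 * (d%:Z - 1)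
     - ((n%:Z - (d%:Z - 1)) %/ r%:Z)%Z
     - ((n%:Z - 2 * (d%:Z - 1) - ((n%:Z - (d%:Z - 1)) %/ r%:Z)%Z) %/ r%:Z)%Z)%R.
Proof.
move=> a2 k0 rkV [dec dmax] lrc.
have a0 : (0 < a)%N by apply: ltnW.
pose o : 'I_a := Ordinal a0.
have V0 : V != 0 by rewrite -mxrank_eq0 rkV expn_eq0; lia.
have d0 : (0 < d)%N.
  apply: dmax => S; rewrite ltnS leqn0 cards_eq0 => /eqP->; exact: decodes_set0.
have corr (S : {set 'I_n}) : (#|S| < d)%N -> correctable o V S.
  by move/dec; apply: decodes_correctable.
have bound (A B : {set 'I_n}) : [disjoint A & B] -> correctable o V A -> correctable o V B ->
    (k + #|A| + #|B| <= n)%N.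
  move=> dAB cA cB; have := rank_le_of_correctable dAB cA cB.
  rewrite rkV leq_exp2l //; have := cardsC (A :|: B); rewrite cardsU card_ord.
  by rewrite (disjoint_setI0 dAB) cards0; lia.
(* Otherwise all of [[n]] would be correctable, and [bound] with the empty set would give
   [k + n <= n]. *)
have nd : (d.-1 <= n)%N.
  rewrite leqNgt; apply/negP => nd.
  have dT : [disjoint [set: 'I_n] & set0] by rewrite -setI_eq0 setI0.
  have cT : correctable o V setT by apply: corr; rewrite cardsT card_ord; lia.
  have c0 : correctable o V set0 by apply: corr; rewrite cards0.
  by have := bound _ _ dT cT c0; rewrite cardsT card_ord; lia.
have [I hI] := fin_all_exists lrc.
have iI i : i \in I i by have [] := hI i.
have Ir i : (#|I i| <= r)%N by have [] := hI i.
(* A qudit must exist before its recovery set can show that [r > 0]. *)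
have n0 : (0 < n)%N.
  have c0 : correctable o V set0 by apply: corr; rewrite cards0.
  have d00 : [disjoint set0 & (set0 : {set 'I_n})] by rewrite -setI_eq0 setI0.
  by have := bound _ _ d00 c0 c0; lia.
have r0 : (0 < r)%N.
  have := Ir (Ordinal n0); apply: leq_trans.
  by apply/card_gt0P; exists (Ordinal n0).
have greedy := greedy_recoverable (m := d.-1) (P := correctable o V) r0 iI Ir.
have {}greedy : forall x (W : {set 'I_n}), (x * r + d.-1 <= #|W|)%N ->
    exists B : {set 'I_n}, [/\ B \subset W, #|B| = (d.-1 + x)%N & correctable o V B].
  apply: greedy => [D cD|i A dA cA]; first by apply: corr; rewrite cD prednK.
  by have [_ _ rec] := hI i; apply: (correctable_add V0 (iI i) rec dA cA).
(* The largest number of blocks of [r] qudits that fit in [[n]] beside [d - 1] freely chosen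
   ones. *)
pose x := ((n - d.-1) %/ r)%N.
have hx : (x * r <= n - d.-1)%N by apply: leq_divM.
have [|A [_ cA kA]] := greedy x [set: 'I_n].
  by rewrite cardsT card_ord; lia.
have cAC : (#|~: A| = n - (d.-1 + x))%N by have := cardsC A; rewrite card_ord cA; lia.
have nA : (d.-1 + x <= n)%N by have := cardsC A; rewrite card_ord cA; lia.
(* If this failed, [~: A] would have fewer than [d] elements and be correctable, and [bound] for [A]
   and [~: A] would give [k + n <= n]. *)
have n2d : (2 * d.-1 + x <= n)%N.
  rewrite leqNgt; apply/negP => h.
  have dAA : [disjoint A & ~: A] by rewrite disjoints_subset setCK.
  have kAC : correctable o V (~: A) by apply: corr; rewrite cAC; lia.
  by have := bound _ _ dAA kA kAC; rewrite cA cAC; lia.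
pose y := ((n - (2 * d.-1 + x)) %/ r)%N.
have hy : (y * r <= n - (2 * d.-1 + x))%N by apply: leq_divM.
have [|B [BA cB kB]] := greedy y (~: A).
  by rewrite cAC; lia.
have dAB : [disjoint A & B] by rewrite disjoint_sym disjoints_subset.
have := bound _ _ dAB kA kB; rewrite cA cB => hk.
(* By [nd] and [n2d] the truncated differences are exact, so the integer quotients are the natural
   numbers [x] and [y]. *)
have -> : n%:Z - (d%:Z - 1) = (n - d.-1)%N%:Z by lia.
rewrite divz_nat -/x.
have -> : n%:Z - 2 * (d%:Z - 1) - x%:Z = (n - (2 * d.-1 + x))%N%:Z by lia.
rewrite divz_nat -/y.
lia.
Qed.
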